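(* Let $\mathcal{R}$ be a finite interaction range and let the pair interaction site potential $V:(\mathbb{R}^d)^{\mathcal{R}}\to\mathbb{R}$ be defined by $$V(\boldsymbol{g}):=\frac12\sum_{\boldsymbol{\rho}=(\rho;\alpha,\beta)\in\mathcal{R}}\phi_{\alpha\beta}\big(|g_{\boldsymbol{\rho}}|\big),\qquad \boldsymbol{g}=\{g_{\boldsymbol{\rho}}\}_{\boldsymbol{\rho}\in\mathcal{R}}.$$ Suppose that $\mathcal{R}=\,\sim\!\mathcal{R}$ and $\phi_{\alpha\beta}=\phi_{\beta\alpha}$ for all $\alpha,\beta\in\{0,1\}$. Then $V$ satisfies the point symmetry $$V\big(\{g_{\boldsymbol{\rho}}\}_{\boldsymbol{\rho}\in\mathcal{R}}\big)=V\big(\{-g_{\sim\boldsymbol{\rho}}\}_{\boldsymbol{\rho}\in\mathcal{R}}\big)\qquad\text{for all }\{g_{\boldsymbol{\rho}}\}_{\boldsymbol{\rho}\in\mathcal{R}}\in(\mathbb{R}^d)^{\mathcal{R}}.$$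
   Context: Here $d\in\{1,2,3\}$. An interaction range $\mathcal{R}$ is a finite subset of $\mathbb{Z}^d\times\{0,1\}\times\{0,1\}\setminus\{(0;0,0),(0;1,1)\}$; its elements are written $\boldsymbol{\rho}=(\rho;\alpha,\beta)$. The operation $\sim$ on $\mathbb{Z}^d\times\{0,1\}\times\{0,1\}$ is $\sim(\rho;\alpha,\beta):=(-\rho;\beta,\alpha)$, and $\sim\!\mathcal{R}:=\{\sim\!\boldsymbol{\rho}:\boldsymbol{\rho}\in\mathcal{R}\}$. The pair potentials $\phi_{\alpha\beta}\in C^3([0,\infty);\mathbb{R})$, $\alpha,\beta\in\{0,1\}$, vanish beyond some cut-off radius $r_c\in(0,\infty)$. *)

(* Defs.v *)
From mathcomp Require Import all_boot all_order all_algebra finmap.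
From mathcomp Require Import all_classical all_reals all_analysis.

Set Implicit Arguments.
Unset Strict Implicit.
Unset Printing Implicit Defensive.

Import Order.TTheory GRing.Theory Num.Theory.
Import numFieldNormedType.Exports.

Local Open Scope classical_set_scope.
Local Open Scope fset_scope.
Local Open Scope ring_scope.

(* Z^d x {0,1} x {0,1}; the element (rho; alpha, beta) is ((rho, alpha), beta). *)
Notation bond d := ('rV[int]_d * 'I_2 * 'I_2)%type.

Section Bonds.
Variable d : nat.
Implicit Types (b : bond d) (Rg : {fset bond d}).

Definition species1 b : 'I_2 := b.1.2.
Definition species2 b : 'I_2 := b.2.

Definition interaction_range Rg : Prop :=
  (0, 0, 0) \notin Rg /\ (0, 1, 1) \notin Rg.

Definition sim b : bond d := (- b.1.1, b.2, b.1.2).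

Definition simR Rg : {fset bond d} := [fset sim b | b in Rg].

Lemma sim_mem Rg b : Rg = simR Rg -> b \in Rg -> sim b \in Rg.
Proof. by move=> eqR bR; rewrite eqR; apply/imfsetP; exists b. Qed.

(* The map rho |-> ~rho as a self-map of Rg, available when Rg = ~Rg. *)
Definition sim_in Rg (eqR : Rg = simR Rg) (b : Rg) : Rg :=
  [` sim_mem eqR (valP b)].

End Bonds.

Section PairPotential.
Variable R : realType.

(* Euclidean norm; the library's `|x| on 'rV[R]_d is the sup norm. *)
Definition enorm (d : nat) (x : 'rV[R]_d) : R :=
  Num.sqrt (\sum_(i < d) x ord0 i ^+ 2).

(* f'(x) = l for f restricted to [0, +oo); one-sided at x = 0. *)
Definition derive_halfline (f : R -> R) (x l : R) : Prop :=
  (f y - f x) / (y - x) @[y --> within `[0, +oo[ x^'] --> l.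

(* f restricted to [0, +oo) is of class C^n; the values of f and of its
   derivatives D k on negative arguments are irrelevant. *)
Definition Cn_halfline (n : nat) (f : R -> R) : Prop :=
  exists D : nat -> R -> R,
    [/\ forall x : R, 0 <= x -> D 0%N x = f x,
        forall k (x : R), (k < n)%N -> 0 <= x -> derive_halfline (D k) x (D k.+1 x)
      & {within `[0, +oo[, continuous (D n)}].

Definition vanishes_beyond (rc : R) (f : R -> R) : Prop :=
  forall r, rc < r -> f r = 0.

Definition site_potential (d : nat) (phi : 'I_2 -> 'I_2 -> R -> R)
    (Rg : {fset bond d}) (g : {ffun Rg -> 'rV[R]_d}) : R :=
  2^-1 * \sum_(b : Rg) phi (species1 (val b)) (species2 (val b)) (enorm (g b)).

End PairPotential.

(* Main.v *)
Require Import Defs.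
From mathcomp Require Import all_boot all_order all_algebra finmap.
From mathcomp Require Import all_classical all_reals all_analysis.

Set Implicit Arguments.
Unset Strict Implicit.
Unset Printing Implicit Defensive.

Import Order.TTheory GRing.Theory Num.Theory.
Import numFieldNormedType.Exports.

Local Open Scope fset_scope.
Local Open Scope ring_scope.

(** The map [sim] is an involution, so when the range is stable under it,
    [sim_in] permutes the bonds of the range and may be used to reindex the sum
    defining the potential (this is [reindex_inj], whose injectivity hypothesis
    is [sim_in_inj]). Reindexing the left-hand sum evaluates [g] at [sim b], as
    on the right, but with the two species of the bond exchanged. The exchange
    is harmless because [phi] is symmetric in its species, and the sign in front
    of [g] because the Euclidean norm is even ([enormN]). The symmetry of [phi]
    is only assumed on the half-line, whence [enorm_ge0]. *)

Lemma simK d : involutive (@sim d).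
Proof. by case=> [[rho alpha] beta]; rewrite /sim /= opprK. Qed.

Lemma sim_in_inj d (Rg : {fset bond d}) (eqR : Rg = simR Rg) :
  injective (sim_in eqR).
Proof.
move=> b c /(congr1 val) /= simbc.
by apply/val_inj/(can_inj (@simK d)).
Qed.

Lemma enorm_ge0 (R : realType) d (x : 'rV[R]_d) : 0 <= enorm x.
Proof. exact: sqrtr_ge0. Qed.

Lemma enormN (R : realType) d (x : 'rV[R]_d) : enorm (- x) = enorm x.
Proof.
by congr Num.sqrt; apply: eq_bigr => i _; rewrite mxE sqrrN.
Qed.

Theorem proposition4p3 (R : realType) (d : nat) (hd : (1 <= d <= 3)%N)
    (Rg : {fset bond d}) (hRg : interaction_range Rg)
    (phi : 'I_2 -> 'I_2 -> R -> R) (rc : R) (hrc : 0 < rc)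
    (phiC3 : forall alpha beta, Cn_halfline 3 (phi alpha beta))
    (phi_rc : forall alpha beta, vanishes_beyond rc (phi alpha beta))
    (eqR : Rg = simR Rg)
    (phi_sym : forall alpha beta (r : R), 0 <= r -> phi alpha beta r = phi beta alpha r)
    (g : {ffun Rg -> 'rV[R]_d}) :
  site_potential phi g =
  site_potential phi [ffun b : Rg => - g (sim_in eqR b)].
Proof.
rewrite /site_potential; congr (_ * _).
rewrite (reindex_inj (@sim_in_inj d Rg eqR)) /=.
apply: eq_bigr => b _.
by rewrite ffunE enormN phi_sym ?enorm_ge0.
Qed.
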